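(* Let $q$ be a nonzero polynomial holomorphic sextic differential on $\mathbb{C}$, let $\nu_q$ be its associated almost-complex curve, and let $\Delta=\partial_\infty\nu_q\subset\mathrm{Ein}^{2,3}$ be its boundary at infinity, a polygon whose vertices are written cyclically as $(p_i)_{i\in\mathbb{Z}_n}$. Then: (i) $d_3(p_i,p_{i+j})=j$ for all $i\in\mathbb{Z}_n$ and $j\in\{0,1,2,3\}$; (ii) away from the vertices, $\Delta$ is an integral curve of the $(2,3,5)$ distribution $\mathscr{D}$ on $\mathrm{Ein}^{2,3}$.
   Context: Split octonions: $\mathbb{O}'=\mathbb{H}\oplus\mathbb{H}$ with product $(a,b)\odot(c,d)=(ac+db^*,\,a^*d+cb)$ ($*$ = quaternionic conjugation), $l=(0,1)$, $(a,b)=a+lb$, $\mathbb{H}=(\mathbb{H},0)$ with units $i,j,k$. The bilinear form is $(a+lb)\cdot(c+ld)=\langle a,c\rangle_{\mathbb{H}}-\langle b,d\rangle_{\mathbb{H}}$; $\mathrm{Im}\,\mathbb{O}'=1^\perp$ (signature $(3,4)$); $x\times y$ is the component of $x\odot y$ in $\mathrm{Im}\,\mathbb{O}'$. $\mathsf{G}_2'$ is the group of $\mathbb{R}$-algebra automorphisms of $\mathbb{O}'$. All structures are extended $\mathbb{C}$-linearly to $(\mathrm{Im}\,\mathbb{O}')^{\mathbb{C}}$ (scalar imaginary unit $\sqrt{-1}$). Put $\mathrm{Ein}^{2,3}=\{[x]\in\mathbb{P}(\mathrm{Im}\,\mathbb{O}'): x\cdot x=0\}$ and $\mathrm{Ann}(u)=\{v\in\mathrm{Im}\,\mathbb{O}':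 u\times v=0\}$. $d_3:\mathrm{Ein}^{2,3}\times\mathrm{Ein}^{2,3}\to\{0,1,2,3\}$ is given by $d_3([u],[v])=0$ if $[u]=[v]$; $=1$ if $[u]\neq[v]$ and $u\times v=0$; $=2$ if $u\cdot v=0$ and $u\times v\ne0$; $=3$ if $u\cdot v\neq0$. $\mathscr{D}$: identify $T_{[u]}\mathrm{Ein}^{2,3}\cong\mathrm{Hom}_{\mathbb{R}}([u],u^\perp/[u])$; then $\mathscr{D}_{[u]}=\{X : X([u])\subset \mathrm{Ann}(u)/[u]\}$, a rank 2 distribution. An integral curve of $\mathscr{D}$ is a curve whose tangent line at each point lies in $\mathscr{D}$. Associated curve: write $q=q(z)\,dz^6$. Let $(u_1,u_2)$ be the unique complete real solution on $\mathbb{C}$ of $2\partial_z\partial_{\bar z}u_1=5e^{u_1-3u_2}-2e^{-2u_1}|q|^2$, $2\partial_z\partial_{\bar z}u_2=6e^{2u_2}-5e^{u_1-3u_2}$, where complete means that $e^{u_1-3u_2}|dz|^2$, $e^{2u_2}|dz|^2$ are complete and $|q|^2e^{-2u_1}|dz|^2$ is complete away from the zeros of $q$. Put $r=e^{u_1-u_2}$, $s=e^{2u_2}$. Use the ordered basis $(e_3,e_2,e_1,e_0,e_{-1},e_{-2},e_{-3})$ of $(\mathrm{Im}\,\mathbb{O}')^{\mathbb{C}}$ with $e_{\pm3}=\tfrac1{\sqrt2}(jl\pm\sqrt{-1}\,kl)$, $e_{\pm2}=\tfrac1{\sqrt2}(j\pm\sqrt{-1}\,k)$, $e_{\pm1}=\tfrac1{\sqrt2}(l\pm\sqrt{-1}\,il)$,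 $e_0=i$ (products in $\mathbb{O}'$). In it let $H=\mathrm{diag}(\tfrac1{rs},\tfrac1r,\tfrac1s,1,s,r,rs)$; let $\varphi$ be the matrix with $\varphi e_3=\sqrt3e_2$, $\varphi e_2=\sqrt5e_1$, $\varphi e_1=-\sqrt{-6}\,e_0$, $\varphi e_0=-\sqrt{-6}\,e_{-1}$, $\varphi e_{-1}=\sqrt5e_{-2}$, $\varphi e_{-2}=q\,e_3+\sqrt3e_{-3}$, $\varphi e_{-3}=q\,e_2$ ($\sqrt{-6}=\sqrt6\sqrt{-1}$); and $\varphi^{*h}=H^{-1}\overline{\varphi}^TH$. There is a unique $\psi:\mathbb{C}\to GL_7(\mathbb{C})$ with $\psi^{-1}\partial_z\psi=\varphi+H^{-1}\partial_zH$, $\psi^{-1}\partial_{\bar z}\psi=\varphi^{*h}$, $\psi(0)=\mathrm{Id}$. The associated almost-complex curve, well defined up to $\mathsf{G}_2'$, is $\nu_q(z)=H(0)^{1/2}\psi(z)e_0\in\{x\in\mathrm{Im}\,\mathbb{O}':x\cdot x=1\}$. A natural coordinate for $q$ is a local holomorphic function $w$ with $(dw)^6=q(z)dz^6$. A $q$-ray is a path $\gamma:\mathbb{R}_{\ge0}\to\mathbb{C}$ that is a Euclidean ray $w(\gamma(t))=te^{\sqrt{-1}\theta}+c$ in a natural coordinate $w$. Then $\partial_\infty\nu_q=\{\lim_{t\to\infty}[\nu_q(\gamma(t))] : \gamma \text{ a } q\text{-ray}\}$. It is a polygon with $n=\deg q+6$ vertices satisfying the annihilator property: a union of projective line segments $L_i\subset\mathrm{Ein}^{2,3}$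 $(i\in\mathbb{Z}_n)$ with endpoints $p_i,p_{i+1}$, where $p_i\ne p_{i+1}$, $p_i\cdot p_{i+1}=0$, and $\mathrm{Ann}(p_i)=\mathrm{span}_{\mathbb{R}}\langle p_{i-1},p_i,p_{i+1}\rangle$ for all $i$; the $p_i$ are its vertices. *)

(* Defs.v *)
From HB Require Import structures.
From mathcomp Require Import all_boot all_order all_algebra.
From mathcomp Require Import all_classical all_reals all_analysis.
From mathcomp Require Import complex.

Set Implicit Arguments.
Unset Strict Implicit.
Unset Printing Implicit Defensive.

Import Order.TTheory GRing.Theory Num.Theory.
Import numFieldNormedType.Exports.

Local Open Scope classical_set_scope.
Local Open Scope ring_scope.

(** * Split octonions *)

(* Everything is defined over an arbitrary field K of scalars: K = R gives the
   split octonions, and K = R[i] their complexification with all structures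
   extended C-linearly.  Quaternions are row vectors of coordinates with
   respect to 1, i, j, k; the pair (a, b) stands for a + l b. *)
Notation octonion K := ('rV[K]_4 * 'rV[K]_4)%type.

Section SplitOctonions.
Variable K : fieldType.
Implicit Types a b : 'rV[K]_4.
Implicit Types x y : octonion K.

Definition quat (t0 t1 t2 t3 : K) : 'rV[K]_4 :=
  \row_(m < 4) [:: t0; t1; t2; t3]`_m.

Definition qcoord (m : 'I_4) a : K := a 0 m.
Local Notation "a # m" := (qcoord (@Ordinal 4 m isT) a) (at level 2).

Definition qmul a b : 'rV[K]_4 :=
  quat (a#0 * b#0 - a#1 * b#1 - a#2 * b#2 - a#3 * b#3)
       (a#0 * b#1 + a#1 * b#0 + a#2 * b#3 - a#3 * b#2)
       (a#0 * b#2 - a#1 * b#3 + a#2 * b#0 + a#3 * b#1)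
       (a#0 * b#3 + a#1 * b#2 - a#2 * b#1 + a#3 * b#0).

Definition qconj a : 'rV[K]_4 := quat (a#0) (- a#1) (- a#2) (- a#3).

Definition qdot a b : K := \sum_(m < 4) a 0 m * b 0 m.

Definition omul x y : octonion K :=
  (qmul x.1 y.1 + qmul y.2 (qconj x.2), qmul (qconj x.1) y.2 + qmul y.1 x.2).

Definition odot x y : K := qdot x.1 y.1 - qdot x.2 y.2.

Definition oone : octonion K := (quat 1 0 0 0, 0).
Definition oi : octonion K := (quat 0 1 0 0, 0).
Definition oj : octonion K := (quat 0 0 1 0, 0).
Definition ok : octonion K := (quat 0 0 0 1, 0).
Definition ol : octonion K := (0, quat 1 0 0 0).

Definition ImO : set (octonion K) := [set x | odot oone x = 0].

(* oone has norm 1, so this is the projection of x (.) y to ImO along oone. *)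
Definition ocross x y : octonion K :=
  omul x y - odot oone (omul x y) *: oone.

Definition Ann (u : octonion K) : set (octonion K) :=
  [set v | ImO v /\ ocross u v = 0].

Definition G2' (g : octonion K -> octonion K) : Prop :=
  [/\ linear g, bijective g & forall x y, g (omul x y) = omul (g x) (g y)].

(** * The Einstein universe *)

(* Points of projective space are lines, as elements of {vspace _}. *)
Definition Ein : set {vspace octonion K} :=
  [set P | exists u, [/\ ImO u, u != 0, odot u u = 0 & P = <[u]>%VS]].

(* [vpick P] is a nonzero vector of P when P is a line.  The conditions
   below that mention it are invariant under rescaling it. *)
Definition d3 (P Q : {vspace octonion K}) : nat :=
  if P == Q then 0%N
  else if ocross (vpick P) (vpick Q) == 0 then 1%N
  else if odot (vpick P) (vpick Q) == 0 then 2%N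
  else 3%N.

End SplitOctonions.

(** * Integral curves of the (2,3,5) distribution *)

Section Curves.
Variable R : realType.
Local Notation oct := (octonion R).

(* A tangent vector X : [u] -> u^perp / [u] of Ein at [u] is given by a lift
   w of X u.  For a path [x t] in Ein, the velocity at [x t] sends x t to the
   class of x' t. *)
Definition calD (u w : oct) : Prop :=
  odot u w = 0 /\ exists (a : oct) (c : R), Ann u a /\ w = a + c *: u.

(* An injective smooth immersion ]0, 1[ -> Ein, through a smooth lift. *)
Definition regular_arc (x : R -> oct) : Prop :=
  [/\ (forall (k : nat) (t : R), 0 < t < 1 -> derivable (derive1n k x) t 1),
      (forall t : R, 0 < t < 1 -> Ein <[x t]>%VS),
      (forall t : R, 0 < t < 1 -> derive1 x t \notin <[x t]>%VS) &
      (forall s t : R, 0 < s < 1 -> 0 < t < 1 -> <[x s]>%VS = <[x t]>%VS -> s = t)].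

(* A curve is an immersed 1-manifold with countable base: it may have several
   components, and these are not required to be disjoint. *)
Definition integral_curve (C : set {vspace oct}) : Prop :=
  exists A : set (R -> oct),
    [/\ countable A,
        (forall x, A x -> regular_arc x),
        (forall x, A x -> forall t : R, 0 < t < 1 ->
           calD (x t) (derive1 x t)) &
        C = \bigcup_(x in A) [set <[x t]>%VS | t in [set t | 0 < t < 1]]].

(** * Polygons with the annihilator property *)

(* For a fixed u, the two choices of sign of v give the two segments of the
   projective line through P and Q. *)
Definition proj_segment (P Q : {vspace oct}) (S : set {vspace oct}) : Prop :=
  exists u v : oct, [/\ u != 0, v != 0, P = <[u]>%VS, Q = <[v]>%VS &
    S = [set T | exists a b : R,
           [/\ 0 <= a, 0 <= b, 0 < a + b & T = <[a *: u + b *: v]>%VS]]].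

(* 'Z_n is Z/n only for n >= 2; the polygons below have n >= 6. *)
Definition annihilator_polygon (n : nat) (p : 'Z_n -> {vspace oct})
    (Delta : set {vspace oct}) : Prop :=
  exists L : 'Z_n -> set {vspace oct},
    [/\ (forall i, [/\ Ein (p i), p i <> p (i + 1),
           odot (vpick (p i)) (vpick (p (i + 1))) = 0 &
           Ann (vpick (p i)) =
             [set v | v \in (p (i - 1)%R + p i + p (i + 1)%R)%VS]]),
        (forall i, proj_segment (p i) (p (i + 1)) (L i)),
        (forall i, L i `<=` @Ein R) &
        Delta = \bigcup_(i in [set: 'Z_n]) L i].

End Curves.

(** * Calculus on the complex plane *)

(* R[i]^o carries the norm topology and the complex derivative. *)

Section Plane.
Variable R : realType.
Local Notation C := R[i].
Local Notation I := ('i%C : C).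
Local Notation "x %:C" := (real_complex R x) : ring_scope.
Local Notation normc := (@Normc.normc R).

Definition pderiv (v : C) (f : C -> R) (z : C) : R :=
  derive1 (fun t : R => f (z + t%:C * v)) 0.

(* C^k as a function of two real variables *)
Fixpoint Ck (k : nat) (f : C -> R) : Prop :=
  if k is k'.+1 then
    forall v, v = 1 \/ v = I ->
      (forall z, derivable (fun t : R => f (z + t%:C * v)) 0 1) /\
      Ck k' (pderiv v f)
  else continuous (f : C^o -> R).

Definition CkC (k : nat) (F : C -> C) : Prop :=
  Ck k (fun z => complex.Re (F z)) /\ Ck k (fun z => complex.Im (F z)).

Definition pderivC (v : C) (F : C -> C) (z : C) : C :=
  (pderiv v (fun w => complex.Re (F w)) z)%:C +
  I * (pderiv v (fun w => complex.Im (F w)) z)%:C.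

Definition dz (F : C -> C) (z : C) : C :=
  2^-1 * (pderivC 1 F z - I * pderivC I F z).
Definition dzbar (F : C -> C) (z : C) : C :=
  2^-1 * (pderivC 1 F z + I * pderivC I F z).

Definition dz_mx m n (F : C -> 'M[C]_(m, n)) (z : C) : 'M[C]_(m, n) :=
  \matrix_(a, b) dz (fun w => F w a b) z.
Definition dzbar_mx m n (F : C -> 'M[C]_(m, n)) (z : C) : 'M[C]_(m, n) :=
  \matrix_(a, b) dzbar (fun w => F w a b) z.

(** ** Complete conformal metrics rho |dz|^2 *)

Definition C1_path (a b : C) : set (R -> C) :=
  [set g | [/\ g 0 = a, g 1 = b &
     forall h : R -> R,
       h = (fun t => complex.Re (g t)) \/ h = (fun t => complex.Im (g t)) ->
       (forall t, derivable h t 1) /\ continuous (derive1 h)]].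

Definition speed (g : R -> C) (t : R) : R :=
  Num.sqrt ((derive1 (fun s => complex.Re (g s)) t) ^+ 2 +
            (derive1 (fun s => complex.Im (g s)) t) ^+ 2).

Definition conf_length (rho : C -> R) (g : R -> C) : \bar R :=
  (\int[lebesgue_measure]_(t in `[0%R, 1%R])
     (Num.sqrt (rho (g t)) * speed g t)%:E)%E.

Definition conf_dist (rho : C -> R) (a b : C) : \bar R :=
  ereal_inf [set conf_length rho g | g in C1_path a b].

(* rho >= 0 may vanish at isolated points; conf_dist is then still a distance
   on the whole plane, the zeros of rho being at finite distance, and this says
   that the metric is complete away from them. *)
Definition complete_metric (rho : C -> R) : Prop :=
  forall x : nat -> C,
    (forall e : R, 0 < e -> exists N, forall m n, (N <= m)%N -> (N <= n)%N ->
       (conf_dist rho (x m) (x n) < e%:E)%E) ->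
    exists l : C, conf_dist rho (x n) l @[n --> \oo] --> 0%E.

(** * The almost-complex curve of a polynomial sextic differential q dz^6 *)

Definition Toda_complete_solution (q : {poly C}) (u1 u2 : C -> R) : Prop :=
  [/\ Ck 2 u1 /\ Ck 2 u2,
      (forall z, 2 * dz (dzbar (fun w => (u1 w)%:C)) z =
         (5 * expR (u1 z - 3 * u2 z)
          - 2 * expR (- 2 * u1 z) * normc q.[z] ^+ 2)%:C),
      (forall z, 2 * dz (dzbar (fun w => (u2 w)%:C)) z =
         (6 * expR (2 * u2 z) - 5 * expR (u1 z - 3 * u2 z))%:C),
      complete_metric (fun z => expR (u1 z - 3 * u2 z)) /\
      complete_metric (fun z => expR (2 * u2 z)) &
      complete_metric (fun z => normc q.[z] ^+ 2 * expR (- 2 * u1 z))].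

(* Index a : 'I_7 corresponds to e_(3 - a). *)
Definition ebasis (a : 'I_7) : octonion C :=
  let jl := omul (oj C) (ol C) in
  let kl := omul (ok C) (ol C) in
  let il := omul (oi C) (ol C) in
  let c := ((Num.sqrt 2)^-1)%:C in
  [:: c *: (jl + I *: kl); c *: (oj C + I *: ok C); c *: (ol C + I *: il);
      oi C;
      c *: (ol C - I *: il); c *: (oj C - I *: ok C); c *: (jl - I *: kl)]`_a.

Definition Hdiag (u1 u2 : C -> R) (z : C) : 'rV[R]_7 :=
  let r := expR (u1 z - u2 z) in
  let s := expR (2 * u2 z) in
  \row_(a < 7) [:: (r * s)^-1; r^-1; s^-1; 1; s; r; r * s]`_a.

Definition Hmx (u1 u2 : C -> R) (z : C) : 'M[C]_7 :=
  diag_mx (map_mx (fun x => x%:C) (Hdiag u1 u2 z)).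

Definition Hsqrt (u1 u2 : C -> R) (z : C) : 'M[C]_7 :=
  diag_mx (map_mx (fun x => (Num.sqrt x)%:C) (Hdiag u1 u2 z)).

(* Column b holds the coordinates of phi e_(3 - b). *)
Definition phi (q : {poly C}) (z : C) : 'M[C]_7 :=
  \matrix_(a < 7, b < 7)
    match nat_of_ord a, nat_of_ord b with
    | 1%N, 0%N => (Num.sqrt 3)%:C
    | 2%N, 1%N => (Num.sqrt 5)%:C
    | 3%N, 2%N => - ((Num.sqrt 6)%:C * I)
    | 4%N, 3%N => - ((Num.sqrt 6)%:C * I)
    | 5%N, 4%N => (Num.sqrt 5)%:C
    | 0%N, 5%N => q.[z]
    | 6%N, 5%N => (Num.sqrt 3)%:C
    | 1%N, 6%N => q.[z]
    | _, _ => 0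
    end.

Definition phi_star (q : {poly C}) (u1 u2 : C -> R) (z : C) : 'M[C]_7 :=
  invmx (Hmx u1 u2 z) *m (map_mx (@conjc R) (phi q z))^T *m Hmx u1 u2 z.

Definition parallel_frame (q : {poly C}) (u1 u2 : C -> R) (psi : C -> 'M[C]_7)
    : Prop :=
  [/\ (forall z, psi z \in unitmx),
      (forall a b, CkC 1 (fun z => psi z a b)),
      (forall z, invmx (psi z) *m dz_mx psi z =
         phi q z + invmx (Hmx u1 u2 z) *m dz_mx (Hmx u1 u2) z),
      (forall z, invmx (psi z) *m dzbar_mx psi z = phi_star q u1 u2 z) &
      psi 0 = 1%:M].

Definition complexify (x : octonion R) : octonion C :=
  (map_mx (fun t => t%:C) x.1, map_mx (fun t => t%:C) x.2).

(* The vector H(0)^(1/2) psi(z) e_0 is real, i.e. it is the image of some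
   nu0 z in the split octonions.  The curve is defined up to G2'. *)
Definition associated_curve (q : {poly C}) (nu : C -> octonion R) : Prop :=
  exists u1 u2 psi (nu0 : C -> octonion R) (g : octonion R -> octonion R),
    [/\ Toda_complete_solution q u1 u2,
        parallel_frame q u1 u2 psi,
        (forall z, complexify (nu0 z) =
           \sum_(a < 7) (Hsqrt u1 u2 0 *m psi z) a (@Ordinal 7 3 isT) *: ebasis a),
        G2' g &
        nu = g \o nu0].

(** * Boundary at infinity *)

(* w is a coordinate, hence injective on its domain U; it is then a
   biholomorphism onto w @` U, so g is continuous on the nonnegative reals.
   Only the values of g there are used. *)
Definition q_ray (q : {poly C}) (g : R -> C) : Prop :=
  exists (U : set C^o) (w : C^o -> C^o) (theta : R) (c : C),
    [/\ open U,
        (forall z, U z -> derivable w z 1 /\ ('D_1 w z : C) ^+ 6 = q.[z]),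
        set_inj U w &
        forall t : R, 0 <= t -> U (g t) /\
          w (g t) = t%:C * ((cos theta)%:C + I * (sin theta)%:C) + c].

(* [x t] tends to [y] in projective space as t tends to +oo *)
Definition proj_cvg (x : R -> octonion R) (y : octonion R) : Prop :=
  y != 0 /\ exists c : R -> R, (forall t, c t != 0) /\
    c t *: x t @[t --> +oo%R] --> y.

Definition boundary_at_infinity (q : {poly C}) (nu : C -> octonion R) :
    set {vspace octonion R} :=
  [set P | exists g y, [/\ q_ray q g, proj_cvg (nu \o g) y & P = <[y]>%VS]].

End Plane.

(* Main.v *)
Require Import Defs.
From HB Require Import structures.
From mathcomp Require Import all_boot all_order all_algebra.
From mathcomp Require Import all_classical all_reals all_analysis.
From mathcomp Require Import complex.
From mathcomp Require Import ring lra.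
Set Implicit Arguments.
Unset Strict Implicit.
Unset Printing Implicit Defensive.
Import Order.TTheory GRing.Theory Num.Theory.
Import numFieldNormedType.Exports.
Local Open Scope classical_set_scope.
Local Open Scope ring_scope.

(** Both claims follow from the annihilator property of the boundary polygon and
    from the algebra of the split cross product.

    (i) Incidence of null lines [u], [v], meaning u * v = 0, makes Ein the points
    of the split Cayley generalized hexagon, which contains no ordinary
    k-gon with k < 6.  Concretely, the cross product satisfies
      (x * y) * z + x * (y * z) = 2 (x . z) y - (x . y) z - (y . z) x
    ([ocross_triple]).  For consecutive vertices a, b, c, d it forces a . c = 0.
    Moreover a * c is nonzero: Ann b is spanned by a, b, c and contains two
    elements with nonzero product ([Ann_noncommuting]).  This is distance 2.  In
    the same way b * d is nonzero, and it is a multiple k c of c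
    ([ocross_span_line]).  The identity for a, b, d now says
    k (a * c) = 2 (a . d) b, so a . d is nonzero, which is distance 3.

    (ii) The plane spanned by two consecutive vertices has zero cross product, so
    that along a side the position u and the velocity w of an affine
    parametrization satisfy u * w = 0; this is tangency to the distribution
    ([calD_subarc]).  What remains of a side once the vertices are removed is open
    in it, and is therefore a union of countably many affine arcs with rational
    ends ([exists_rational_subarc]). *)

(** * The split cross product in coordinates *)

Section Coordinates.
(* Otherwise simplification expands quaternion products before their operands
   are in normal form. *)
Local Arguments qmul : simpl never.
Local Arguments qconj : simpl never.
Local Arguments qdot : simpl never.

Variable K : fieldType.

Lemma quat_eta (a : 'rV[K]_4) : exists t0 t1 t2 t3, a = quat t0 t1 t2 t3.
Proof.
exists (a 0 (@Ordinal 4 0 isT)), (a 0 (@Ordinal 4 1 isT)),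
  (a 0 (@Ordinal 4 2 isT)), (a 0 (@Ordinal 4 3 isT)).
apply/rowP; case=> -[|[|[|[|//]]]] lt_m4; rewrite mxE /=;
  by congr (a _ _); apply: val_inj.
Qed.

Lemma quatD (a0 a1 a2 a3 b0 b1 b2 b3 : K) :
  quat a0 a1 a2 a3 + quat b0 b1 b2 b3 =
  quat (a0 + b0) (a1 + b1) (a2 + b2) (a3 + b3).
Proof. by apply/rowP; case=> -[|[|[|[|//]]]] lt_m4; rewrite !mxE. Qed.

Lemma quatZ (c a0 a1 a2 a3 : K) :
  c *: quat a0 a1 a2 a3 = quat (c * a0) (c * a1) (c * a2) (c * a3).
Proof. by apply/rowP; case=> -[|[|[|[|//]]]] lt_m4; rewrite !mxE. Qed.

Lemma quatN (a0 a1 a2 a3 : K) :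
  - quat a0 a1 a2 a3 = quat (- a0) (- a1) (- a2) (- a3).
Proof. by apply/rowP; case=> -[|[|[|[|//]]]] lt_m4; rewrite !mxE. Qed.

Lemma quat0 : 0 = quat 0 0 0 0 :> 'rV[K]_4.
Proof. by apply/rowP; case=> -[|[|[|[|//]]]] lt_m4; rewrite !mxE. Qed.

Lemma qmul_quat (a0 a1 a2 a3 b0 b1 b2 b3 : K) :
  qmul (quat a0 a1 a2 a3) (quat b0 b1 b2 b3) =
  quat (a0 * b0 - a1 * b1 - a2 * b2 - a3 * b3)
       (a0 * b1 + a1 * b0 + a2 * b3 - a3 * b2)
       (a0 * b2 - a1 * b3 + a2 * b0 + a3 * b1)
       (a0 * b3 + a1 * b2 - a2 * b1 + a3 * b0).
Proof. by rewrite /qmul /qcoord !mxE. Qed.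

Lemma qconj_quat (a0 a1 a2 a3 : K) :
  qconj (quat a0 a1 a2 a3) = quat a0 (- a1) (- a2) (- a3).
Proof. by rewrite /qconj /qcoord !mxE. Qed.

Lemma qdot_quat (a0 a1 a2 a3 b0 b1 b2 b3 : K) :
  qdot (quat a0 a1 a2 a3) (quat b0 b1 b2 b3) =
  a0 * b0 + a1 * b1 + a2 * b2 + a3 * b3.
Proof. by rewrite /qdot !big_ord_recl big_ord0 !mxE /= addr0 !addrA. Qed.

Lemma octD (a b c d : 'rV[K]_4) : (a, b) + (c, d) = (a + c, b + d).
Proof. by []. Qed.

Lemma octN (a b : 'rV[K]_4) : - (a, b) = (- a, - b).
Proof. by []. Qed.

Lemma octZ k (a b : 'rV[K]_4) : k *: (a, b) = (k *: a, k *: b) :> octonion K.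
Proof. by []. Qed.

Lemma oct0 : 0 = (0, 0) :> octonion K.
Proof. by []. Qed.

Lemma ImO_coord (x : octonion K) :
  ImO x <-> exists a1 a2 a3 b0 b1 b2 b3,
    x = (quat 0 a1 a2 a3, quat b0 b1 b2 b3).
Proof.
case: x => a b; have [a0 [a1 [a2 [a3 ->]]]] := quat_eta a.
have [b0 [b1 [b2 [b3 ->]]]] := quat_eta b.
rewrite /ImO /= /odot /oone /= [X in qdot X (quat b0 _ _ _)]quat0 !qdot_quat.
rewrite !mul0r !addr0 subr0 mul1r; split=> [->|[? [? [? [? [? [? [? []]]]]]]]].
  by exists a1, a2, a3, b0, b1, b2, b3.
by move/(congr1 (fun t : 'rV_4 => t 0 (@Ordinal 4 0 isT))); rewrite !mxE.
Qed.

Local Ltac coord x :=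
  let a := fresh "a" in let b := fresh "b" in
  case: x => a b;
  let a0 := fresh "a" in let a1 := fresh "a" in
  let a2 := fresh "a" in let a3 := fresh "a" in
  let b0 := fresh "b" in let b1 := fresh "b" in
  let b2 := fresh "b" in let b3 := fresh "b" in
  have [a0 [a1 [a2 [a3 ->]]]] := quat_eta a;
  have [b0 [b1 [b2 [b3 ->]]]] := quat_eta b.
Local Ltac im_coord x :=
  case/ImO_coord: x => ? [? [? [? [? [? [? ->]]]]]].

Lemma odot_quat (a0 a1 a2 a3 b0 b1 b2 b3 c0 c1 c2 c3 d0 d1 d2 d3 : K) :
  odot (quat a0 a1 a2 a3, quat b0 b1 b2 b3)
       (quat c0 c1 c2 c3, quat d0 d1 d2 d3) =
  a0 * c0 + a1 * c1 + a2 * c2 + a3 * c3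
  - (b0 * d0 + b1 * d1 + b2 * d2 + b3 * d3).
Proof. by rewrite /odot !qdot_quat. Qed.

Lemma ocross_quat (a0 a1 a2 a3 b0 b1 b2 b3 c0 c1 c2 c3 d0 d1 d2 d3 : K) :
  ocross (quat a0 a1 a2 a3, quat b0 b1 b2 b3)
         (quat c0 c1 c2 c3, quat d0 d1 d2 d3) =
  (quat 0
     (a0 * c1 + a1 * c0 + a2 * c3 - a3 * c2
      - d0 * b1 + d1 * b0 - d2 * b3 + d3 * b2)
     (a0 * c2 - a1 * c3 + a2 * c0 + a3 * c1
      - d0 * b2 + d1 * b3 + d2 * b0 - d3 * b1)
     (a0 * c3 + a1 * c2 - a2 * c1 + a3 * c0
      - d0 * b3 - d1 * b2 + d2 * b1 + d3 * b0),
   quat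
     (a0 * d0 + a1 * d1 + a2 * d2 + a3 * d3
      + c0 * b0 - c1 * b1 - c2 * b2 - c3 * b3)
     (a0 * d1 - a1 * d0 - a2 * d3 + a3 * d2
      + c0 * b1 + c1 * b0 + c2 * b3 - c3 * b2)
     (a0 * d2 + a1 * d3 - a2 * d0 - a3 * d1
      + c0 * b2 - c1 * b3 + c2 * b0 + c3 * b1)
     (a0 * d3 - a1 * d2 + a2 * d1 - a3 * d0
      + c0 * b3 + c1 * b2 - c2 * b1 + c3 * b0)).
Proof.
rewrite /ocross /omul /oone quat0 /= !qconj_quat !qmul_quat !quatD odot_quat.
rewrite octZ octN octD !(quatZ, quatN, quatD).
congr (quat _ _ _ _, quat _ _ _ _); ring.
Qed.

Local Ltac coordE :=
  rewrite !(octD, octN, octZ, quatZ, quatN, quatD, ocross_quat, odot_quat).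
Local Ltac oct_ring := coordE; congr (quat _ _ _ _, quat _ _ _ _); ring.
Local Ltac scalar_ring := coordE; ring.

Lemma ocrossDl (x y z : octonion K) :
  ocross (x + y) z = ocross x z + ocross y z.
Proof. coord x; coord y; coord z; oct_ring. Qed.

Lemma ocrossDr (x y z : octonion K) :
  ocross x (y + z) = ocross x y + ocross x z.
Proof. coord x; coord y; coord z; oct_ring. Qed.

Lemma ocrossZl k (x y : octonion K) : ocross (k *: x) y = k *: ocross x y.
Proof. coord x; coord y; oct_ring. Qed.

Lemma ocrossZr k (x y : octonion K) : ocross x (k *: y) = k *: ocross x y.
Proof. coord x; coord y; oct_ring. Qed.

Lemma ocrossxx (x : octonion K) : ImO x -> ocross x x = 0.
Proof. move=> hx; im_coord hx; rewrite oct0 quat0; oct_ring. Qed.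

Lemma odotZl k (x y : octonion K) : odot (k *: x) y = k * odot x y.
Proof. coord x; coord y; scalar_ring. Qed.

Lemma odotDl (x y z : octonion K) : odot (x + y) z = odot x z + odot y z.
Proof. coord x; coord y; coord z; scalar_ring. Qed.

Lemma odotC (x y : octonion K) : odot x y = odot y x.
Proof. coord x; coord y; scalar_ring. Qed.

Lemma ocrossC (x y : octonion K) :
  ImO x -> ImO y -> ocross x y = - ocross y x.
Proof. move=> hx hy; im_coord hx; im_coord hy; oct_ring. Qed.

Lemma ImO_ocross (x y : octonion K) : ImO (ocross x y).
Proof. rewrite /ImO /= /oone quat0; coord x; coord y; scalar_ring. Qed.

Lemma odot_ocross (x y : octonion K) :
  ImO x -> ImO y -> odot x (ocross x y) = 0.
Proof. move=> hx hy; im_coord hx; im_coord hy; scalar_ring. Qed.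

(** The polarized form of alternativity, x (x y) = (x x) y, rewritten for the
    cross product. *)
Lemma ocross_triple (x y z : octonion K) :
  ImO x -> ImO y -> ImO z ->
  ocross (ocross x y) z + ocross x (ocross y z) =
  (2 * odot x z) *: y - odot x y *: z - odot y z *: x.
Proof. move=> hx hy hz; im_coord hx; im_coord hy; im_coord hz; oct_ring. Qed.

End Coordinates.

(** * Annihilators of null vectors *)

Section SplitCrossProduct.
Variable K : fieldType.
Implicit Types u x y z : octonion K.

Lemma odotZr k x y : odot x (k *: y) = k * odot x y.
Proof. by rewrite odotC odotZl odotC. Qed.

Lemma odotDr x y z : odot x (y + z) = odot x y + odot x z.
Proof. by rewrite odotC odotDl !(odotC x). Qed.

Lemma ImOD x y : ImO x -> ImO y -> ImO (x + y).
Proof. by rewrite /ImO /= odotDr => -> ->; rewrite addr0. Qed.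

Lemma ImOZ k x : ImO x -> ImO (k *: x).
Proof. by rewrite /ImO /= odotZr => ->; rewrite mulr0. Qed.

Lemma ocross0r x : ocross x 0 = 0.
Proof. by rewrite -(scale0r x) ocrossZr !scale0r. Qed.

Lemma ocross0l x : ocross 0 x = 0.
Proof. by rewrite -(scale0r x) ocrossZl !scale0r. Qed.

Lemma ocross_null_twice u x : ImO u -> ImO x -> odot u u = 0 ->
  ocross u (ocross u x) = odot u x *: u.
Proof.
move=> Iu Ix u0; have := ocross_triple Iu Iu Ix.
rewrite ocrossxx // u0 scale0r subr0 ocross0l add0r => ->.
by rewrite -scalerBl; congr (_ *: _); ring.
Qed.

(** On the orthogonal of a null vector u, multiplication by u squares to zero. *)
Lemma Ann_ocross u x : ImO u -> ImO x -> odot u u = 0 -> odot u x = 0 ->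
  Ann u (ocross u x).
Proof.
move=> Iu Ix u0 ux; split; first exact: ImO_ocross.
by rewrite ocross_null_twice // ux scale0r.
Qed.

Lemma Ann_orthogonal u x : ImO u -> u != 0 -> odot u u = 0 -> Ann u x ->
  odot u x = 0.
Proof.
move=> Iu un0 u0 [Ix ux]; have := ocross_null_twice Iu Ix u0.
rewrite ux ocross0r => /esym/eqP; rewrite scaler_eq0 (negPf un0) orbF.
by move/eqP.
Qed.

(** The product that [Ann u] inherits takes its values in the line of u, through
    the alternating form (x, y) |-> (u * x) . y on the orthogonal of u. *)
Lemma ocross_Ann_images u x y : ImO u -> ImO x -> ImO y ->
  odot u u = 0 -> odot u x = 0 -> odot u y = 0 ->
  ocross (ocross u x) (ocross u y) = (2 * odot (ocross u x) y) *: u.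
Proof.
move=> Iu Ix Iy u0 ux uy; have Iux := ImO_ocross u x.
have := ocross_triple Iux Iu Iy.
rewrite (ocrossC Iux Iu) ocross_null_twice // ux scale0r oppr0.
rewrite (odotC (ocross u x) u) odot_ocross // uy !scale0r !subr0.
by rewrite ocross0l add0r.
Qed.

End SplitCrossProduct.

(** * Annihilators spanned by three vectors *)

Section Hexagon.
Variable R : realType.
Implicit Types a b c u x y : octonion R.

(** By [ocross_Ann_images] it is enough to find x, y orthogonal to u with
    (u * x) . y nonzero.  The quaternion part a of u is nonzero, because u is null
    and nonzero.  Take x = e and y = a e for a nonzero imaginary quaternion e
    orthogonal to a: then (u * x) . y = |a|^2 |e|^2. *)
Lemma Ann_noncommuting u : ImO u -> u != 0 -> odot u u = 0 ->
  exists x y, [/\ Ann u x, Ann u y & ocross x y != 0].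
Proof.
move=> Iu un0 u0.
suff [x [y [[Ix Iy] [ux uy]]] uxy] : exists x y, [/\ ImO x /\ ImO y,
    odot u x = 0 /\ odot u y = 0 & odot (ocross u x) y != 0].
  exists (ocross u x), (ocross u y); split; try exact: Ann_ocross.
  by rewrite ocross_Ann_images // scaler_eq0 negb_or un0 mulf_neq0 // pnatr_eq0.
have /ImO_coord[a1 [a2 [a3 [b0 [b1 [b2 [b3 Eu]]]]]]] := Iu.
have a_n0 : a1 ^+ 2 + a2 ^+ 2 + a3 ^+ 2 != 0.
  apply: contraNneq un0 => a0; move: u0; rewrite Eu odot_quat => u0.
  have b_0 : b0 ^+ 2 + b1 ^+ 2 + b2 ^+ 2 + b3 ^+ 2 = 0 by lra.
  move/eqP: a0; move/eqP: b_0.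
  rewrite !paddr_eq0 ?addr_ge0 ?sqr_ge0 // !sqrf_eq0.
  move=> /andP[/andP[/andP[/eqP-> /eqP->] /eqP->] /eqP->].
  by move=> /andP[/andP[/eqP-> /eqP->] /eqP->]; rewrite -quat0.
(* A quaternion orthogonal to a is sought as the vector product of a with g. *)
have perp g1 g2 g3 :
  let e1 := a2 * g3 - a3 * g2 in let e2 := a3 * g1 - a1 * g3 in
  let e3 := a1 * g2 - a2 * g1 in
  e1 ^+ 2 + e2 ^+ 2 + e3 ^+ 2 != 0 ->
  exists x y, [/\ ImO x /\ ImO y,
    odot u x = 0 /\ odot u y = 0 & odot (ocross u x) y != 0].
  move=> e1 e2 e3 e_n0; exists (quat 0 e1 e2 e3, quat 0 0 0 0).
  exists (quat 0 (a2 * e3 - a3 * e2) (a3 * e1 - a1 * e3) (a1 * e2 - a2 * e1),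
          quat 0 0 0 0).
  split; first by split; apply/ImO_coord; do 7!eexists.
    by rewrite Eu !odot_quat /e1 /e2 /e3; split; ring.
  rewrite Eu ocross_quat odot_quat.
  rewrite [X in X != 0](_ : _ = (a1 ^+ 2 + a2 ^+ 2 + a3 ^+ 2)
     * (e1 ^+ 2 + e2 ^+ 2 + e3 ^+ 2)); first by rewrite mulf_neq0.
  rewrite /e1 /e2 /e3; ring.
have [a12|a12] := eqVneq (a1 ^+ 2 + a2 ^+ 2) 0.
  apply: (perp 1 0 0); apply: contraNneq a_n0 => /= e0.
  by have := sqr_ge0 a1; have := sqr_ge0 a2; have := sqr_ge0 a3; lra.
by apply: (perp 0 0 1); apply: contraNneq a12 => /= e0; lra.
Qed.

Lemma span3P a b c x :
  reflect (exists k l m, x = k *: a + l *: b + m *: c)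
          (x \in (<[a]> + <[b]> + <[c]>)%VS).
Proof.
apply: (iffP memv_addP).
  case=> _ /memv_addP[_ /vlineP[k ->] [_ /vlineP[l ->] ->]].
  by case=> _ /vlineP[m ->] ->; exists k, l, m.
move=> [k [l [m ->]]]; exists (k *: a + l *: b); last first.
  by exists (m *: c) => //; apply: memvZ; apply: memv_line.
by apply: memv_add; apply: memvZ; apply: memv_line.
Qed.

Section Chain.
Variables a b c : octonion R.
Hypotheses (Ib : ImO b) (b_neq0 : b != 0) (b_null : odot b b = 0).
Hypothesis Ann_b : Ann b = [set v | v \in (<[a]> + <[b]> + <[c]>)%VS].

Let Annb x : Ann b x <-> x \in (<[a]> + <[b]> + <[c]>)%VS.
Proof. by rewrite Ann_b. Qed.

Lemma Ann_span_l : Ann b a.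
Proof. by apply/Annb/span3P; exists 1, 0, 0; rewrite scale1r !scale0r !addr0. Qed.

Lemma Ann_span_r : Ann b c.
Proof. by apply/Annb/span3P; exists 0, 0, 1; rewrite scale1r !scale0r !add0r. Qed.

(** A vanishing product would make all products in [Ann b] vanish, against
    [Ann_noncommuting]. *)
Lemma ocross_span_neq0 : ocross a c != 0.
Proof.
have [[Ia ba] [Ic bc]] := (Ann_span_l, Ann_span_r).
have [x [y [/Annb/span3P[k [l [m ->]]] /Annb/span3P[k' [l' [m' ->]]]]]] :=
  Ann_noncommuting Ib b_neq0 b_null.
apply: contraNneq => ac.
rewrite !(ocrossDl, ocrossDr, ocrossZl, ocrossZr) !ocrossxx //.
rewrite (ocrossC Ia Ib) (ocrossC Ic Ib) (ocrossC Ic Ia) ba bc ac.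
by rewrite !(oppr0, scaler0, addr0).
Qed.

(** Annihilators are totally isotropic: associating a, b, c in both ways gives
    0 = 2 (a . c) b. *)
Lemma odot_span_eq0 : odot a c = 0.
Proof.
have [[Ia ba] [Ic bc]] := (Ann_span_l, Ann_span_r).
have := ocross_triple Ia Ib Ic.
rewrite (ocrossC Ia Ib) ba bc oppr0 ocross0r (odotC a b).
have -> := Ann_orthogonal Ib b_neq0 b_null Ann_span_l.
have -> := Ann_orthogonal Ib b_neq0 b_null Ann_span_r.
rewrite !scale0r !subr0 ocross0l addr0 => /esym/eqP.
by rewrite scaler_eq0 (negPf b_neq0) orbF mulf_eq0 pnatr_eq0 => /eqP.
Qed.

(** Here a * c annihilates each of a, b, c, and an element of the span of a, b, c
    that annihilates both a and c has no component along c or a. *)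
Lemma ocross_span_line : odot a a = 0 -> odot c c = 0 ->
  exists2 k, k != 0 & ocross a c = k *: b.
Proof.
move=> a0 c0; have [[Ia ba] [Ic bc]] := (Ann_span_l, Ann_span_r).
have ab : ocross a b = 0 by rewrite ocrossC // ba oppr0.
have cb : ocross c b = 0 by rewrite ocrossC // bc oppr0.
have acn0 := ocross_span_neq0; have ac0 := odot_span_eq0.
have can0 : ocross c a != 0 by rewrite ocrossC // oppr_eq0.
have Ann_ac : Ann b (ocross a c).
  split; first exact: ImO_ocross.
  have := ocross_triple Ib Ia Ic.
  have := Ann_orthogonal Ib b_neq0 b_null Ann_span_l => ->.
  have := Ann_orthogonal Ib b_neq0 b_null Ann_span_r => ->.
  by rewrite ba ac0 mulr0 !scale0r !subr0 ocross0l add0r.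
have a_ac : ocross a (ocross a c) = 0.
  by rewrite ocross_null_twice // ac0 scale0r.
have c_ac : ocross c (ocross a c) = 0.
  rewrite (ocrossC Ia Ic) -scaleN1r ocrossZr ocross_null_twice //.
  by rewrite odotC ac0 scale0r scaler0.
have /Annb/span3P[k [l [m E]]] := Ann_ac.
move: a_ac c_ac; rewrite E !(ocrossDr, ocrossZr) ab cb !ocrossxx //.
rewrite !scaler0 !addr0 add0r => /eqP.
rewrite scaler_eq0 (negPf acn0) orbF => /eqP m0 /eqP.
rewrite scaler_eq0 (negPf can0) orbF => /eqP k0.
exists l; last by rewrite -E E k0 m0 !scale0r add0r addr0.
by apply: contraNneq acn0 => l0; rewrite E k0 l0 m0 !scale0r !addr0.
Qed.

End Chain.

Lemma line_vpick u : u != 0 ->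
  exists2 k, k != 0 & vpick <[u]>%VS = k *: u.
Proof.
move=> un0; have /vlineP[k Ek] := memv_pick <[u]>%VS.
exists k => //; apply: contraNneq un0 => k0.
have : vpick <[u]>%VS == 0 by rewrite Ek k0 scale0r.
by rewrite vpick0 -dimv_eq0 dim_vline eqb0 negbK.
Qed.

Lemma lineZ k u : k != 0 -> <[k *: u]>%VS = <[u]>%VS.
Proof.
move=> kn0; apply/eqP; rewrite eqEsubv -!memvE memvZ ?memv_line //=.
by apply/vlineP; exists k^-1; rewrite scalerK.
Qed.

End Hexagon.

(** * Affine arcs in a projective segment *)

Section Arcs.
Variable R : realType.
Local Notation oct := (octonion R).
Implicit Types u v w c x : oct.

Lemma Ein_line x : Ein <[x]>%VS -> ImO x /\ odot x x = 0.
Proof.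
case=> y [Iy _ y0 xy]; have /vlineP[k ->] : x \in <[y]>%VS.
  by rewrite -xy memv_line.
by split; [exact: ImOZ | rewrite odotZl odotZr y0 !mulr0].
Qed.

Lemma is_derive_line c w (t : R) : is_derive t 1 (fun s : R => c + s *: w) w.
Proof.
have dlin : is_derive t 1 (fun s : R => s *: w) w.
  apply: DeriveDef; first exact/diff_derivable.
  by rewrite deriveE // diff_val scale1r.
have := @is_deriveD _ _ _ (cst c) (fun s : R => s *: w) t 1 0 w
  (is_derive_cst _ _ _) dlin.
by rewrite add0r.
Qed.

Lemma derive1_line c w : derive1 (fun t : R => c + t *: w) = cst w.
Proof.
apply/funext => t; rewrite derive1E.
exact: (@derive_val _ _ _ _ _ _ _ (is_derive_line c w t)).
Qed.

Lemma derivable_derive1n_line c w k (t : R) :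
  derivable (derive1n k (fun t : R => c + t *: w)) t 1.
Proof.
case: k => [|k]; first exact: (@ex_derive _ _ _ _ _ _ _ (is_derive_line c w t)).
suff [d ->] : exists d, derive1n k.+1 (fun t : R => c + t *: w) = cst d.
  exact: derivable_cst.
elim: k => [|k [d IHk]]; first by exists w; rewrite derive1n1 derive1_line.
exists 0; rewrite derive1nS IHk; apply/funext => s.
by rewrite derive1E derive_cst.
Qed.

Section Segment.
Variables u v : oct.
Hypotheses (u_neq0 : u != 0) (v_neq0 : v != 0) (uv : <[u]>%VS <> <[v]>%VS).

Lemma free_segment_ends (k l : R) : k *: u + l *: v = 0 -> k = 0 /\ l = 0.
Proof.
move=> klE.
have l0 : l = 0.
  apply/eqP/negPn/negP => l_neq0; apply: uv.
  have k_neq0 : k != 0.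
    apply: contra_eq_neq klE => ->; rewrite scale0r add0r scaler_eq0.
    by rewrite negb_or l_neq0.
  have -> : u = (- (k^-1 * l)) *: v.
    apply: (scalerI k_neq0); rewrite scalerA mulrN mulVKf // scaleNr.
    by apply/eqP; rewrite -addr_eq0 klE.
  by rewrite lineZ // oppr_eq0 mulf_neq0 // invr_eq0.
split=> //; move/eqP: klE; rewrite l0 scale0r addr0 scaler_eq0 (negPf u_neq0).
by rewrite orbF => /eqP.
Qed.

Definition segment_point (t : R) : oct := (1 - t) *: u + t *: v.

Lemma segment_point_neq0 t : segment_point t != 0.
Proof.
by apply/eqP => /free_segment_ends[? t0]; lra.
Qed.

Lemma segment_point_inj s t :
  <[segment_point s]>%VS = <[segment_point t]>%VS -> s = t.
Proof.
move=> st; have /vlineP[k] : segment_point s \in <[segment_point t]>%VS.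
  by rewrite -st memv_line.
rewrite /segment_point scalerDr !scalerA => E.
have [] := @free_segment_ends ((1 - s) - k * (1 - t)) (s - k * t).
  by rewrite (scalerBl (1 - s)) (scalerBl s) addrACA E -opprD subrr.
move=> e1 e2; have k1 : k = 1 by lra.
by move: e2; rewrite k1; lra.
Qed.

Definition subarc (r s t : R) : oct := segment_point (r + (s - r) * t).

Lemma subarcE r s :
  subarc r s = fun t => segment_point r + t *: ((s - r) *: (v - u)).
Proof.
apply/funext => t; rewrite /subarc /segment_point scalerA scalerBr.
rewrite (addrC (_ *: v) (- _)) addrACA -scaleNr -!scalerDl.
by congr (_ *: _ + _ *: _); ring.
Qed.

Hypothesis seg_Ein : forall t : R, 0 < t < 1 -> Ein <[segment_point t]>%VS.
Hypotheses (Iu : ImO u) (Iv : ImO v) (cross_uv : ocross u v = 0).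
Variables r s : R.
Hypotheses (r_ge0 : 0 <= r) (s_le1 : s <= 1) (r_lt_s : r < s).

Lemma subarc_param t : 0 < t < 1 -> 0 < r + (s - r) * t < 1.
Proof.
move=> /andP[t0 t1]; have d0 : 0 < s - r by rewrite subr_gt0.
have := mulr_gt0 d0 t0.
have : 0 < (s - r) * (1 - t) by rewrite mulr_gt0 ?subr_gt0.
move=> p1 p2; apply/andP; split.
  by apply: le_lt_trans r_ge0 _; lra.
by apply: lt_le_trans s_le1; lra.
Qed.

Lemma regular_subarc : regular_arc (subarc r s).
Proof.
have sr : s - r != 0 by rewrite subr_eq0 gt_eqF.
split=> [k t _|t /subarc_param a01|t _|a b _ _ /segment_point_inj].
- by rewrite subarcE; exact: derivable_derive1n_line.
- exact: seg_Ein.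
- rewrite {1}subarcE derive1_line /=.
  apply/negP => /vlineP[k]; rewrite /subarc /segment_point.
  move: (r + _) => a E.
  have [] := @free_segment_ends (- (s - r) - k * (1 - a)) ((s - r) - k * a).
    rewrite (scalerBl (- (s - r))) (scalerBl (s - r)) addrACA -!scalerA.
    by rewrite -opprD -scalerDr -E scaleNr scalerBr [- _ + _]addrC subrr.
  move=> e1 e2; have k0 : k = 0 by lra.
  by move: e2 sr; rewrite k0 mul0r subr0 => ->; rewrite eqxx.
- by move/addrI/(mulfI sr).
Qed.

(** The velocity itself annihilates the position, because both lie in the plane of
    u and v, on which the cross product vanishes. *)
Lemma calD_subarc t : 0 < t < 1 -> calD (subarc r s t) (derive1 (subarc r s) t).
Proof.
move=> /subarc_param a01.
have [Ix x_null] : ImO (subarc r s t) /\ odot (subarc r s t) (subarc r s t) = 0.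
  by exact/Ein_line/seg_Ein.
set x' := derive1 _ _.
have x'E : x' = (s - r) *: (v - u) by rewrite /x' subarcE derive1_line.
have Ix' : ImO x'.
  by rewrite x'E; apply: ImOZ; apply: ImOD => //; rewrite -scaleN1r; apply: ImOZ.
have xx' : ocross (subarc r s t) x' = 0.
  rewrite x'E /subarc /segment_point -(scaleN1r u).
  rewrite !(ocrossDl, ocrossDr, ocrossZl, ocrossZr) (ocrossC Iv Iu) cross_uv.
  by rewrite !ocrossxx // !(oppr0, scaler0, addr0).
split.
  by apply: Ann_orthogonal => //; exact: segment_point_neq0.
exists x', 0; split=> //.
  by rewrite scale0r addr0.
Qed.

End Segment.
End Arcs.

(** * Polygons with the annihilator property *)

Section Polygon.
Variables (R : realType) (n : nat) (p : 'Z_n -> {vspace octonion R}).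
Variable Delta : set {vspace octonion R}.
Hypothesis Delta_polygon : annihilator_polygon p Delta.
Local Notation a i := (vpick (p i)).

Lemma vertexP i :
  [/\ ImO (a i), a i != 0, odot (a i) (a i) = 0 & p i = <[a i]>%VS].
Proof.
have [_ [vertex _ _ _]] := Delta_polygon.
have [[u [Iu un0 u0 ->]] _ _ _] := vertex i.
have [k kn0 ->] := line_vpick un0; split.
- exact: ImOZ.
- by rewrite scaler_eq0 negb_or kn0.
- by rewrite odotZl odotZr u0 !mulr0.
- by rewrite lineZ.
Qed.

Lemma Ann_vertex i :
  Ann (a i) = [set v | v \in (<[a (i - 1)%R]> + <[a i]> + <[a (i + 1)%R]>)%VS].
Proof.
have [_ [vertex _ _ _]] := Delta_polygon; have [_ _ _ ->] := vertex i.
by have [[_ _ _ <-] [_ _ _ <-] [_ _ _ <-]] :=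
  And3 (vertexP (i - 1)) (vertexP i) (vertexP (i + 1)).
Qed.

Lemma Ann_next_vertex i :
  Ann (a (i + 1)) = [set v | v \in
    (<[a i]> + <[a (i + 1)%R]> + <[a (i + 1 + 1)%R]>)%VS].
Proof. by rewrite Ann_vertex addrK. Qed.

Lemma ocross_next i : ocross (a i) (a (i + 1)) = 0.
Proof. by have [] := Ann_span_r (Ann_vertex i). Qed.

Lemma next_vertex_neq i : p i <> p (i + 1).
Proof. by have [_ [vertex _ _ _]] := Delta_polygon; have [] := vertex i. Qed.

Lemma vertex_neq i j : ocross (a i) (a j) != 0 -> p i != p j.
Proof.
by apply: contraNneq => ->; have [Ij _ _ _] := vertexP j; rewrite ocrossxx.
Qed.

Lemma d3_vertex2 i : d3 (p i) (p (i + 1 + 1)) = 2%N.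
Proof.
have [Ib bn0 b0 _] := vertexP (i + 1); have Annb := Ann_next_vertex i.
have cross := ocross_span_neq0 Ib bn0 b0 Annb.
by rewrite /d3 (negPf (vertex_neq cross)) (negPf cross)
  (odot_span_eq0 Ib bn0 b0 Annb) eqxx.
Qed.

(** If a, b, c, d are consecutive, then b * d = k c with k nonzero, so that
    [ocross_triple] applied to a, b, d reads k (a * c) = 2 (a . d) b; as a * c is
    nonzero, so is a . d. *)
Lemma d3_vertex3 i : d3 (p i) (p (i + 1 + 1 + 1)) = 3%N.
Proof.
have [Ia an0 a0 _] := vertexP i.
have [Ib bn0 b0 _] := vertexP (i + 1); have Annb := Ann_next_vertex i.
have [Ic cn0 c0 _] := vertexP (i + 1 + 1); have Annc := Ann_next_vertex (i + 1).
have [Id dn0 d0 _] := vertexP (i + 1 + 1 + 1).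
have cross_ac := ocross_span_neq0 Ib bn0 b0 Annb.
have [k kn0 bd] := ocross_span_line Ic cn0 c0 Annc b0 d0.
have := ocross_triple Ia Ib Id.
rewrite ocross_next ocross0l add0r bd ocrossZr.
rewrite (odot_span_eq0 Ic cn0 c0 Annc) scale0r subr0.
rewrite (Ann_orthogonal Ia an0 a0 (Ann_span_r (Ann_vertex i))) scale0r subr0 => E.
have dot_ad : odot (a i) (a (i + 1 + 1 + 1)) != 0.
  apply/eqP => ad0; move/eqP: E; rewrite ad0 mulr0 scale0r scaler_eq0.
  by rewrite (negPf kn0) (negPf cross_ac).
have cross_ad : ocross (a i) (a (i + 1 + 1 + 1)) != 0.
  apply: contraNneq dot_ad => ad0; apply/eqP.
  exact: (Ann_orthogonal Ia an0 a0 (conj Id ad0)).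
by rewrite /d3 (negPf (vertex_neq cross_ad)) (negPf cross_ad) (negPf dot_ad).
Qed.

Lemma polygon_d3 i j : (j <= 3)%N -> d3 (p i) (p (i + j%:R)) = j.
Proof.
case: j => [|[|[|[|//]]]] _.
- by rewrite addr0 /d3 eqxx.
- by rewrite /d3 ocross_next eqxx; case: eqP => // /next_vertex_neq.
- by rewrite mulr2n addrA d3_vertex2.
- by rewrite mulrS mulr2n !addrA d3_vertex3.
Qed.

(** Some vertices may lie inside a side they do not bound; but a side meets the
    finite set of vertices in finitely many points, so each other point of it has
    a neighbourhood in the side that is free of vertices.  Rational ends keep the
    family of these arcs countable. *)
Lemma exists_rational_subarc (u v : octonion R) (t : R) :
  u != 0 -> v != 0 -> <[u]>%VS <> <[v]>%VS -> 0 < t < 1 ->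
  ~ range p <[segment_point u v t]>%VS ->
  exists r s : rat, [/\ 0 <= ratr r :> R, ratr s <= 1 :> R, ratr r < t < ratr s
    & forall x : R, ratr r < x < ratr s -> ~ range p <[segment_point u v x]>%VS].
Proof.
move=> un0 vn0 uv /andP[t_gt0 t_lt1] tp.
have : \forall x \near t, forall j, p j <> <[segment_point u v x]>%VS.
  apply: (@filter_forall _ _
    (fun j => [set x | p j <> <[segment_point u v x]>%VS]) (nbhs t)) => j /=.
  have [[x xj]|noj] := pselect (exists x, p j = <[segment_point u v x]>%VS).
    have tx : t != x by apply: contra_not_neq tp => ->; exists j.
    near=> y; rewrite xj => /(segment_point_inj un0 vn0 uv) xy.
    have : y != x by near: y; exact: open_nbhs_nbhs (conj (@open_neq _ x) tx).
    by rewrite xy eqxx.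
  by near=> x => jx; apply: noj; exists x.
move=> /nbhs_ballP[e /= e0 te].
have [r] : exists r, ratr r \in `](Num.max 0 (t - e)), t[%R.
  by apply: rat_in_itvoo; rewrite gt_max t_gt0 ltrBlDr ltrDl.
rewrite in_itv /= gt_max => /andP[/andP[r0 rte] rt].
have [s] : exists s, ratr s \in `]t, (Num.min 1 (t + e))[%R.
  by apply: rat_in_itvoo; rewrite lt_min t_lt1 ltrDl.
rewrite in_itv /= lt_min => /andP[ts /andP[s1 ste]].
exists r, s; split; [exact: ltW | exact: ltW | by rewrite rt ts|].
move=> x /andP[rx xs] [j _ jx]; apply: (te x _ j jx).
by rewrite /ball /= ltr_distlC; apply/andP; split; lra.
Unshelve. all: by end_near.
Qed.

Lemma polygon_integral_curve : integral_curve (Delta `\` range p).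
Proof.
have [L [_ L_seg L_Ein ->]] := Delta_polygon.
have [u /choice[v uvP]] := choice L_seg.
have un0 i : u i != 0 by case: (uvP i).
have vn0 i : v i != 0 by case: (uvP i).
have pu i : p i = <[u i]>%VS by case: (uvP i).
have pv i : p (i + 1) = <[v i]>%VS by case: (uvP i).
have LE i : L i = [set T | exists a b : R, [/\ 0 <= a, 0 <= b, 0 < a + b &
  T = <[a *: u i + b *: v i]>%VS]] by case: (uvP i).
have uv i : <[u i]>%VS <> <[v i]>%VS by rewrite -pu -pv; exact: next_vertex_neq.
have L_pt i (t : R) : 0 < t < 1 -> L i <[segment_point (u i) (v i) t]>%VS.
  by move=> /andP[t0 t1]; rewrite LE; exists (1 - t), t; split=> //; lra.
have EinP i : Ein (p i) by case: Delta_polygon => ? [/(_ i)[]].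
have Iu i : ImO (u i) by have := EinP i; rewrite pu => /Ein_line[].
have Iv i : ImO (v i) by have := EinP (i + 1); rewrite pv => /Ein_line[].
have cross_uv i : ocross (u i) (v i) = 0.
  have [k kn0 Ek] := line_vpick (un0 i); have [l ln0 El] := line_vpick (vn0 i).
  have := ocross_next i; rewrite pu pv Ek El ocrossZl ocrossZr => /eqP.
  by rewrite !scaler_eq0 (negPf kn0) (negPf ln0) => /eqP.
pose arc (m : 'Z_n * rat * rat) :=
  subarc (u m.1.1) (v m.1.1) (ratr m.1.2) (ratr m.2).
(* Arcs may overlap, so all rational subintervals serve and the components of
   the complement of the vertices need not be determined. *)
pose good (m : 'Z_n * rat * rat) := [/\ 0 <= ratr m.1.2 :> R,
  ratr m.2 <= 1 :> R, ratr m.1.2 < ratr m.2 :> R &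
  forall x : R, ratr m.1.2 < x < ratr m.2 ->
    ~ range p <[segment_point (u m.1.1) (v m.1.1) x]>%VS].
exists (arc @` [set m | good m]); split.
- exact: sub_countable (card_image_le _ _) (countableP _).
- move=> _ [[[i r] s] [/= r0 s1 rs _] <-].
  by apply: regular_subarc => // t t01; apply/(L_Ein i)/L_pt.
- move=> _ [[[i r] s] [/= r0 s1 rs _] <-] t t01.
  by apply: calD_subarc => // x x01; apply/(L_Ein i)/L_pt.
apply/seteqP; split=> [T [[i _]]|T [_ [[[i r] s] [/= r0 s1 rs avoid] <-]]].
  rewrite LE => -[k [l [k0 l0 kl0 ->]]] kl_p.
  pose t := l / (k + l).
  have kln0 : k + l != 0 by rewrite gt_eqF.
  have kl : <[k *: u i + l *: v i]>%VS = <[segment_point (u i) (v i) t]>%VS.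
    rewrite -[RHS](lineZ _ kln0) /segment_point scalerDr !scalerA.
    by congr (<[_ *: _ + _ *: _]>%VS); rewrite /t; field.
  rewrite kl in kl_p *.
  have t_gt0 : 0 < t.
    rewrite lt_neqAle divr_ge0 ?(ltW kl0) // andbT eq_sym.
    apply: contra_not_neq kl_p => ->; exists i => //.
    by rewrite /segment_point subr0 scale1r scale0r addr0.
  have t_lt1 : t < 1.
    rewrite lt_neqAle ler_pdivrMr // mul1r lerDr k0 andbT.
    apply: contra_not_neq kl_p => ->; exists (i + 1) => //.
    by rewrite /segment_point subrr scale0r scale1r add0r.
  have t01 : 0 < t < 1 by rewrite t_gt0 t_lt1.
  have [r [s [r0 s1 /andP[rt ts] avoid]]] :=
    exists_rational_subarc (un0 i) (vn0 i) (uv i) t01 kl_p.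
  have rs : ratr r < ratr s :> R by exact: lt_trans ts.
  exists (arc (i, r, s)); first by exists (i, r, s).
  exists ((t - ratr r) / (ratr s - ratr r)).
    by rewrite /= divr_gt0 ?subr_gt0 // ltr_pdivrMr ?subr_gt0 // mul1r ltrD2r.
  rewrite /arc /subarc /= mulrC divfK ?subr_eq0 ?gt_eqF //.
  by rewrite addrC subrK.
case=> t t01 <-; have [t0 t1] := andP t01; rewrite /arc /=.
split; first by exists i => //; apply: L_pt; apply: subarc_param.
have d0 : 0 < ratr s - ratr r :> R by rewrite subr_gt0.
apply: avoid; rewrite ltrDl mulr_gt0 // -ltrBrDl.
by rewrite -[ltRHS]mulr1 ltr_pM2l.
Qed.

End Polygon.

Theorem theoremB (R : realType) (q : {poly R[i]}) (nu : R[i] -> octonion R)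
    (p : 'Z_((size q).-1 + 6) -> {vspace octonion R}) :
  q != 0 ->
  associated_curve q nu ->
  annihilator_polygon p (boundary_at_infinity q nu) ->
  (forall (i : 'Z_((size q).-1 + 6)) (j : nat), (j <= 3)%N ->
     d3 (p i) (p (i + j%:R)) = j) /\
  integral_curve (boundary_at_infinity q nu `\` range p).
Proof.
move=> _ _ polygon; split; last exact: polygon_integral_curve polygon.
by move=> i j; exact: polygon_d3 polygon i j.
Qed.
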